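(* Let $1\le p<\infty$, let $T$ be a tree and assume that the forward shift $S$ is an isometry on $\mathbb{H}^p(T)$. Then there exists a sequence $(s_n)_{n\in\mathbb{N}}$ of natural numbers such that $\gamma(1,w)=s_{|w|+1}$ for all vertices $w$ of $T$.
   Context: $\mathbb{N}=\{1,2,\dots\}$ is the set of natural numbers, $\mathbb{N}_0=\{0,1,2,\dots\}$. A tree $T$ means a connected graph with no cycles, with countably infinitely many vertices, locally finite (every vertex has finitely many adjacent vertices), with a distinguished vertex $\mathrm{o}$ called the root. For a vertex $v$, $|v|$ is the number of edges in the unique path between $\mathrm{o}$ and $v$; $v$ is in level $n$ if $|v|=n$, and $\gamma(n)$ is the number of vertices in level $n$. For $v\neq \mathrm{o}$, $\operatorname{par}(v)$ (the parent of $v$) is the unique vertex $w$ on the path from $v$ to $\mathrm{o}$ with $|w|=|v|-1$; the children of $v$ are the vertices $u$ with $\operatorname{par}(u)=v$ (vertices may have no children). $\gamma(1,v)$ is the number of children of $v$. $\mathcal{F}$ is the vector space of all complex-valued functions on the set of vertices of $T$. For $f\in\mathcal{F}$ and $n\in\mathbb{N}_0$, $M_p(n,f):=\left(\frac{1}{\gamma(n)}\sum_{|v|=n}|f(v)|^p\right)^{1/p}$. The Hardy space $\mathbb{H}^p(T)$ is the set of $f\in\mathcal{F}$ with $\|f\|:=\sup_{n\in\mathbb{N}_0}M_p(n,f)<\infty$; it is a Banach space with this norm. The forward shift $S:\mathcal{F}\to\mathcal{F}$ is the linear map $(Sf)(v)=f(\operatorname{par}(v))$ if $v\neq \mathrm{o}$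 and $(Sf)(\mathrm{o})=0$. ''$S$ is an isometry on $\mathbb{H}^p(T)$'' means $S$ maps $\mathbb{H}^p(T)$ into itself and $\|Sf\|=\|f\|$ for all $f\in\mathbb{H}^p(T)$. *)

(* Defs.v *)
From HB Require Import structures.
From mathcomp Require Import all_boot all_order all_algebra finmap.
From mathcomp Require Import all_classical all_reals all_analysis.
From mathcomp.real_closed Require Export complex.

Set Implicit Arguments.
Unset Strict Implicit.
Unset Printing Implicit Defensive.

Import Order.TTheory GRing.Theory Num.Theory.

Local Open Scope classical_set_scope.
Local Open Scope ring_scope.

(* A cycle is a closed walk on at least three pairwise distinct vertices.
   Vertices other than the root are allowed to have no children. *)
Record tree := Tree {
  vertex :> choiceType;
  adj : rel vertex;
  root : vertex;
  adj_sym : symmetric adj;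
  adj_irr : irreflexive adj;
  tree_connected : forall x y : vertex, exists s, path adj x s /\ last x s = y;
  tree_acyclic : forall c : seq vertex, (2 < size c)%N -> ~ ucycle adj c;
  tree_countably_infinite : ([set: vertex] #= [set: nat])%card;
  tree_locally_finite : forall v, finite_set [set u | adj v u]
}.

Section Tree.
Variable T : tree.
Implicit Types u v w : T.

(* The path from the root to v, without its first vertex [root T]. Such a path
   exists and is unique, so the default value of [xget] is never used. *)
Definition root_path v : seq T :=
  xget [::] [set s : seq T |
    [/\ path (@adj T) (root T) s, uniq (root T :: s) & last (root T) s = v]].

(* |v|: the number of edges of a path is the number of its vertices after the
   first one. *)
Definition depth v : nat := size (root_path v).

Definition level (n : nat) : set T := [set v | depth v = n].

(* Levels are finite by local finiteness, so that [fset_set] is not degenerate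
   here; the same holds for the sets of children below. *)
Definition gamma (n : nat) : nat := #|` fset_set (level n)|.

(* Only meaningful for v <> root T; by convention par (root T) = root T. *)
Definition par v : T :=
  xget (root T) [set w | w \in root T :: root_path v /\ (depth w).+1 = depth v].

Definition children v : set T := [set u | u <> root T /\ par u = v].

Definition gamma1 v : nat := #|` fset_set (children v)|.

End Tree.

Arguments level : clear implicits.

Section Hardy.
Variables (R : realType) (p : R) (T : tree).
Implicit Type f : T -> R[i].

Definition Mp (n : nat) f : R :=
  ((gamma T n)%:R^-1 *
   \sum_(v \in level T n) ComplexField.Normc.normc (f v) `^ p) `^ p^-1.

(* The supremum is taken in the extended reals: it is +oo outside H^p(T). *)
Definition hardy_norm f : \bar R := ereal_sup (range (fun n => (Mp n f)%:E)).

Definition hardy : set (T -> R[i]) := [set f | (hardy_norm f < +oo)%E].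

Definition forward_shift f : T -> R[i] :=
  fun v => if v == root T then 0 else f (par v).

Definition forward_shift_isometry : Prop :=
  (forall f, hardy f -> hardy (forward_shift f)) /\
  (forall f, hardy f -> hardy_norm (forward_shift f) = hardy_norm f).

End Hardy.

(* Main.v *)
Require Import Defs.
From mathcomp Require Import all_boot all_order all_algebra finmap.
From mathcomp Require Import all_classical all_reals all_analysis.

Set Implicit Arguments.
Unset Strict Implicit.
Unset Printing Implicit Defensive.

Import Order.TTheory GRing.Theory Num.Theory.

Local Open Scope classical_set_scope.
Local Open Scope ring_scope.

(** For a vertex [w] at level [n], compare the Hardy norms of the indicator
    function of [w] and of its shift. The shift is the indicator of the set of
    children of [w], a subset of level [n + 1], and the indicator of a subset
    [A] of a finite level [n] has norm [(#A / gamma n) ^ (1 / p)]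
    ([hardy_norm_indic]). The isometry therefore gives
    [gamma1 w / gamma (n + 1) = 1 / gamma n], so that
    [gamma1 w = gamma (n + 1) / gamma n] depends only on the level of [w]
    ([gamma1_ratio]).

    The levels must be finite and nonempty for this to make sense. Finiteness
    goes by induction on the level, from local finiteness. Nonemptiness follows
    by induction from the isometry itself: the indicator of a vertex at level
    [n] has a nonzero norm, hence so has its shift, which makes the number of
    children of the vertex positive. The same remark gives that these numbers
    of children form a sequence of positive integers.

    The graph-theoretic input is that simple paths with given end points are
    unique in a tree ([simple_path_unique]), which identifies [par v] with the
    last vertex before [v] on the path from the root to [v]. *)

(** * Paths from the root *)

Section RootPaths.
Local Notation root := Defs.root.
Variable T : tree.
Implicit Types (u v w x : T) (s t : seq T).

(** Once the two paths leave a common vertex [x] along different edges, the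
    part of the first one up to its first vertex [z] after [x] that lies on the
    second one, followed by the second one backwards from [z], is a cycle. *)
Lemma simple_path_unique x s t :
  path (@adj T) x s -> uniq (x :: s) -> path (@adj T) x t -> uniq (x :: t) ->
  last x s = last x t -> s = t.
Proof.
elim: s x t => [|a s IH] x [|b t] //.
- by move=> _ _ _ /= /andP[/negP xbt _] lE; case: xbt; rewrite lE mem_last.
- by move=> _ /= /andP[/negP xas _] _ _ lE; case: xas; rewrite -lE mem_last.
move=> pS uS pT uT lE.
have [ab|ab] := eqVneq a b.
  move: pS uS pT uT lE => /= /andP[_ pS] /andP[_ uS] /andP[_ pT] /andP[_ uT] lE.
  by rewrite -ab in pT uT lE *; rewrite (IH a t).
exfalso.
have : has (mem (b :: t)) (a :: s).
  apply/hasP; exists (last a s); first exact: mem_last.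
  by move: lE => /= ->; exact: mem_last.
have [hs ht] : head x (a :: s) = a /\ head x (b :: t) = b by [].
move: {IH lE} (a :: s) (b :: t) hs ht pS uS pT uT.
move=> s0 t0 hs ht pS uS pT uT meet.
case/split_find: meet hs pS uS => z s1 s2 /= zt.
case/splitPr: t0 / zt pT uT ht => t1 t2 pT uT ht s1t hs pS uS.
apply: (@tree_acyclic T (x :: s1 ++ z :: rev t1)).
  (* both paths would start with the edge from x to z *)
  case: s1 t1 ht hs {pT uT s1t pS uS} => [|c s1] [|d t1] //=
    => [ht hs|_ _|_ _|_ _].
  - by rewrite -hs -ht eqxx in ab.
  - by rewrite size_rev.
  - by rewrite size_cat addnS.
  - by rewrite size_cat addnS.
apply/andP; split.
  have -> : cycle (@adj T) (x :: s1 ++ z :: rev t1) =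
      path (@adj T) x (rcons s1 z ++ rcons (rev t1) x).
    by rewrite /= rcons_cat /= cat_rcons.
  rewrite cat_path last_rcons; apply/andP; split.
    by move: pS; rewrite cat_path => /andP[].
  move: pT; rewrite -cat_rcons cat_path => /andP[+ _].
  have := rev_path (@adj T) x (rcons t1 z).
  rewrite last_rcons belast_rcons rev_cons => ->.
  by rewrite (@eq_path _ _ (@adj T)) // => u v; rewrite adj_sym.
move: uS uT; rewrite -2!cat_rcons /= !mem_cat !mem_rcons !inE mem_rev.
rewrite !cat_uniq !rcons_uniq rev_uniq !negb_or.
move=> /andP[/andP[/andP[xz xs1] _] /andP[/andP[zs1 us1] _]].
move=> /andP[/andP[/andP[_ xt1] _] /andP[/andP[zt1 ut1] _]].
rewrite xs1 xz xt1 us1 ut1 zs1 !andTb andbT.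
apply/hasPn => y; rewrite mem_rev /= mem_rcons inE negb_or => yt1.
rewrite (memPn zt1) //=.
by apply: contraNN s1t => ys1; apply/hasP; exists y; rewrite //= mem_cat yt1.
Qed.

Lemma root_pathP v :
  [/\ path (@adj T) (root T) (root_path v), uniq (root T :: root_path v)
    & last (root T) (root_path v) = v].
Proof.
apply: (@xgetPex _ [::] [set s | [/\ path (@adj T) (root T) s,
  uniq (root T :: s) & last (root T) s = v]]).
have [s [ps <-]] := tree_connected (root T) v.
by case: (shortenP ps) => s' ps' us' _; exists s'.
Qed.

Lemma root_path_eq v s :
  path (@adj T) (root T) s -> uniq (root T :: s) -> last (root T) s = v ->
  root_path v = s.
Proof.
move=> ps us ls; have [pv uv lv] := root_pathP v.
by apply: (simple_path_unique pv uv ps us); rewrite ls lv.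
Qed.

Lemma depth_root : depth (root T) = 0%N.
Proof. by rewrite /depth (@root_path_eq _ [::]). Qed.

Lemma depth_eq0 v : depth v = 0%N -> v = root T.
Proof.
by have [_ _ lv] := root_pathP v; move=> /size0nil E; rewrite -lv E.
Qed.

Lemma root_path_par v : v <> root T -> root_path v = rcons (root_path (par v)) v.
Proof.
move=> v0; have := root_pathP v.
case Es: _ / (lastP (root_path v)) => [|s u] [].
  by move=> _ _ /esym.
rewrite last_rcons => ps us uv; subst u.
have ps' : path (@adj T) (root T) s by move: ps; rewrite rcons_path => /andP[].
have us' : uniq (root T :: s).
  by move: us; rewrite -rcons_cons rcons_uniq => /andP[].
(* every vertex of s is the end of a prefix of s, which is its root path *)
have Ew w : w \in root T :: s -> exists s', s = root_path w ++ s'.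
  move=> ws; case/splitPl: ws ps' us' => s1 s2 l1.
  rewrite cat_path -cat_cons cat_uniq => /andP[p1 _] /andP[u1 _].
  by rewrite (root_path_eq p1 u1 l1); exists s2.
have El : root_path (last (root T) s) = s by exact: root_path_eq.
have [] : par v \in root T :: root_path v /\ (depth (par v)).+1 = depth v.
  apply: (@xgetPex _ (root T) [set w | w \in root T :: root_path v /\
    (depth w).+1 = depth v]).
  exists (last (root T) s); split.
    by rewrite Es -rcons_cons mem_rcons inE mem_last orbT.
  by rewrite /depth El Es size_rcons.
rewrite Es -rcons_cons mem_rcons inE => /orP[/eqP ->|/Ew[s' Es']].
  by move=> /esym /eqP; rewrite ltn_eqF.
rewrite /depth Es size_rcons => -[sz].
have : size s' = 0%N.
  apply/eqP; rewrite -(eqn_add2l (size (root_path (par v)))).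
  by rewrite -size_cat -Es' sz addn0.
by move=> /size0nil s'0; rewrite {1}Es' s'0 cats0.
Qed.

Lemma depth_par v : v <> root T -> depth v = (depth (par v)).+1.
Proof. by move=> v0; rewrite /depth (root_path_par v0) size_rcons. Qed.

Lemma adj_par v : v <> root T -> adj (par v) v.
Proof.
move=> v0; have [+ _ _] := root_pathP v; rewrite (root_path_par v0) rcons_path.
by have [_ _ ->] := root_pathP (par v); move=> /andP[].
Qed.

Lemma level0 : level T 0 = [set root T].
Proof.
apply/seteqP; split => v; first exact: depth_eq0.
by rewrite /level /= => ->; exact: depth_root.
Qed.

Lemma children_sub_level w : children w `<=` level T (depth w).+1.
Proof. by move=> v /= [v0 <-]; exact: depth_par. Qed.

Lemma finite_level n : finite_set (level T n).
Proof.
elim: n => [|n IH]; first by rewrite level0; exact: finite_set1.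
apply: (@sub_finite_set _ _ (\bigcup_(w in level T n) [set v | adj w v])).
  move=> v /= vn; have v0 : v <> root T.
    by move=> v0; move: vn; rewrite v0 /level /= depth_root.
  exists (par v); last exact: adj_par.
  by apply: succn_inj; rewrite -depth_par.
by apply: bigcup_finite => // w _; exact: tree_locally_finite.
Qed.

Lemma level_nonempty n : (0 < gamma T n)%N -> level T n !=set0.
Proof.
move=> g0; apply/set0P; apply: contraTN g0 => /eqP n0.
by rewrite /gamma n0 fset_set0 cardfs0.
Qed.

End RootPaths.

(** * Norms of indicator functions *)

Section Indicators.
Variables (R : realType) (p : R) (T : tree).
Hypothesis p0 : 0 < p.
Implicit Types (A : set T) (n : nat).

Lemma Mp_indic A n : A `<=` level T n ->
  Mp p n (\1_A : T -> R[i]) =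
    ((#|` fset_set A|)%:R / (gamma T n)%:R) `^ p^-1.
Proof.
move=> An; have fA : finite_set A := sub_finite_set An (finite_level _ n).
rewrite /Mp mulrC; congr ((_ / _) `^ _).
rewrite -(fsbig_widen _ _ _ An) /=; last first.
  move=> v [_ /= nAv]; rewrite indicE memNset // ComplexField.Normc.normc0.
  by rewrite powR0 // gt_eqF.
rewrite fsbig_finite //= (eq_big_seq (fun=> 1)); last first.
  move=> v; rewrite in_fset_set // => vA.
  by rewrite indicE vA ComplexField.Normc.normc1 powR1.
by rewrite big_const_seq count_predT iter_addr_0.
Qed.

Lemma Mp_indic_neq A n m : A `<=` level T n -> m <> n ->
  Mp p m (\1_A : T -> R[i]) = 0.
Proof.
move=> An mn; rewrite /Mp fsbig1 ?mulr0 ?powR0 ?gt_eqF ?invr_gt0 //.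
move=> v vm; rewrite indicE memNset ?ComplexField.Normc.normc0 ?powR0 ?gt_eqF //.
by move=> /An vn; apply: mn; rewrite -vm.
Qed.

Lemma hardy_norm_indic A n : A `<=` level T n ->
  hardy_norm p (\1_A : T -> R[i]) =
    (((#|` fset_set A|)%:R / (gamma T n)%:R) `^ p^-1)%:E.
Proof.
move=> An; apply/eqP; rewrite eq_le; apply/andP; split; last first.
  by apply: ereal_sup_ubound; exists n => //; rewrite (Mp_indic An).
apply: ge_ereal_sup => _ [m _ <-]; rewrite lee_fin.
have [->|/eqP mn] := eqVneq m n; first by rewrite (Mp_indic An).
by rewrite (Mp_indic_neq An mn) powR_ge0.
Qed.

Lemma forward_shift_indic1 (w : T) :
  forward_shift (\1_[set w] : T -> R[i]) = \1_(children w).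
Proof.
apply/funext => v; rewrite /forward_shift !indicE.
case: eqP => [->|v0]; first by rewrite memNset // => -[].
by congr (_%:R); congr nat_of_bool; apply/idP/idP; rewrite !inE => // -[].
Qed.

Hypothesis hS : forward_shift_isometry p T.

(** Division by zero being zero, the equality of norms alone does not exclude
    empty levels; the positivity of [gamma T n] does. *)
Lemma gamma1_ratio (w : T) : (0 < gamma T (depth w))%N ->
  (0 < gamma1 w)%N /\
  gamma T (depth w).+1 = (gamma1 w * gamma T (depth w))%N.
Proof.
move=> g0.
have w1 : [set w] `<=` level T (depth w) by move=> _ ->.
have := proj2 hS (\1_[set w]).
rewrite forward_shift_indic1 (hardy_norm_indic (@children_sub_level T w)).
rewrite /hardy /= (hardy_norm_indic w1) fset_set1 cardfs1 ltry => /(_ isT) [].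
rewrite -/(gamma1 w) => Epow.
have E : (gamma1 w)%:R / (gamma T (depth w).+1)%:R =
    (gamma T (depth w))%:R^-1 :> R.
  rewrite -[RHS]mul1r; apply: (@powR_injective _ p^-1); last exact: Epow.
  - by rewrite invr_gt0.
  - by rewrite nnegrE divr_ge0.
  - by rewrite nnegrE divr_ge0.
have gR0 : (gamma T (depth w))%:R != 0 :> R by rewrite pnatr_eq0 -lt0n.
have h0 : (gamma1 w)%:R / (gamma T (depth w).+1)%:R != 0 :> R.
  by rewrite E invr_eq0.
have := h0; rewrite mulf_eq0 invr_eq0 negb_or => /andP[c0 hR0].
split; first by rewrite lt0n -(pnatr_eq0 R).
apply/eqP; rewrite -(eqr_nat R) natrM; apply/eqP.
by rewrite -(divfK hR0 (gamma1 w)%:R) E mulrAC mulVf // mul1r.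
Qed.

Lemma gamma_gt0 n : (0 < gamma T n)%N.
Proof.
elim: n => [|n IH]; first by rewrite /gamma level0 fset_set1 cardfs1.
have [w wn] := level_nonempty IH.
have [] := @gamma1_ratio w; first by rewrite wn.
by rewrite wn => c0 ->; rewrite muln_gt0 c0 IH.
Qed.

End Indicators.

(** * The number of children at each level *)

Theorem proposition3p2p2 (R : realType) (p : R) (hp : 1 <= p) (T : tree)
    (hS : forward_shift_isometry p T) :
  exists s : nat -> nat,
    (forall n : nat, (0 < n)%N -> (0 < s n)%N) /\
    (forall w : T, gamma1 w = s (depth w).+1).
Proof.
have p0 : 0 < p := lt_le_trans ltr01 hp.
have g0 := gamma_gt0 p0 hS.
have sE (w : T) :
    gamma1 w = (gamma T (depth w).+1 %/ gamma T (depth w).+1.-1)%N.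
  by have [_ ->] := gamma1_ratio p0 hS (g0 (depth w)); rewrite mulnK.
exists (fun n => gamma T n %/ gamma T n.-1)%N; split => // -[//|n] _.
have [w wn] := level_nonempty (g0 n).
have [c0 _] := gamma1_ratio p0 hS (g0 (depth w)).
by rewrite -wn -sE.
Qed.
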